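(* Let $(P,\omega,d)$ be a weighted labeled poset, i.e. $P$ is a finite poset with $n$ elements, $\omega:P\to\{1,\dots,n\}$ is a bijection, and $d:P\to\mathbb{N}^+$ is a weight function. Then $$K^d_{(P,\omega)}(\mathbf{x})=\sum_{\alpha}\hat{\psi}_\alpha(\mathbf{x})\sum_{\substack{f\in\mathcal{O}^*(P,\omega)\\ \mathrm{wt}(f,d)=\alpha}}\ \prod_{i=1}^{\ell(\alpha)}\mathrm{sgn}\big(f^{-1}(i)\big)\,d\big(\mathrm{root}(f^{-1}(i))\big),$$ where the outer sum is over all integer compositions $\alpha$ (of $\sum_{a\in P}d(a)$) and $\ell(\alpha)$ is the number of parts of $\alpha$.
   Context: **$(P,\omega)$-partitions.** $\mathbb{N}^+$ denotes the positive integers and $\mathbf{x}=(x_1,x_2,\dots)$. A $(P,\omega)$-partition is a map $f:P\to\mathbb{N}^+$ such that $a<_P b$ implies $f(a)\le f(b)$, and $a<_P b$ together with $\omega(a)>\omega(b)$ implies $f(a)<f(b)$. Define $K^d_{(P,\omega)}(\mathbf{x})=\sum_f\prod_{a\in P}x_{f(a)}^{d(a)}$, the sum over all $(P,\omega)$-partitions $f$. **Quasisymmetric power sums.** A composition is a finite sequence of positive integers. For a composition $\alpha=(\alpha_1,\dots,\alpha_\ell)$, the monomial quasisymmetric function is $M_\alpha(\mathbf{x})=\sum_{i_1<\dots<i_\ell}x_{i_1}^{\alpha_1}\cdots x_{i_\ell}^{\alpha_\ell}$. Write $\alpha\le\beta$ if $\alpha$ refines $\beta$ (equivalently $\beta$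 is a coarsening of $\alpha$), i.e. $\beta=(\beta_1,\dots,\beta_k)$ and $\alpha$ is the concatenation of blocks $(\alpha_{i,1},\dots,\alpha_{i,\ell_i})$, $1\le i\le k$, with $\beta_i=\alpha_{i,1}+\dots+\alpha_{i,\ell_i}$. In that case put $\pi(\alpha,\beta)=\prod_{i=1}^k\alpha_{i,1}(\alpha_{i,1}+\alpha_{i,2})\cdots(\alpha_{i,1}+\dots+\alpha_{i,\ell_i})$. The unnormalized quasisymmetric power sum is $\hat\psi_\alpha(\mathbf{x})=\sum_{\beta\ge\alpha}\frac{1}{\pi(\alpha,\beta)}M_\beta(\mathbf{x})$. (Equivalently $\hat\psi_\alpha=\Psi_\alpha/z_\alpha$, where $\Psi_\alpha=z_\alpha\sum_{\beta\ge\alpha}\pi(\alpha,\beta)^{-1}M_\beta$ and $z_\alpha=\prod_i i^{m_i}m_i!$, with $m_i$ the number of parts of $\alpha$ equal to $i$.) **Border strips.** The following notions are applied to a poset $Q$ with an injective labeling $\omega$ by integers (in particular to sub-posets of $P$ with the order and labeling induced from $P$); only the relative order of labels matters. An edge of $Q$ is a cover relation $a<b$ in the Hasse diagram; it is strict if $\omega(a)>\omega(b)$ and natural if $\omega(a)<\omega(b)$. $(Q,\omega)$ is a generalized border strip if there is no chain $a<b<c$ in $Q$ with $\omega(a)<\omega(b)>\omega(c)$. For a generalized border strip, the LW-tagging $\mathfrak{t}:Q\to\{-1,1^*,+1\}$ is: $\mathfrak{t}(x)=-1$ if $x$ is the bottom element of a strict edge; $\mathfrak{t}(x)=+1$ if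 $x$ is the top element of a natural edge; $\mathfrak{t}(x)=1^*$ otherwise (this is well defined). $(Q,\omega)$ is rooted if it is a generalized border strip and there is a unique $x\in Q$ with $\mathfrak{t}(x)=1^*$; this element is denoted $\mathrm{root}(Q)$. Put $\mathrm{sgn}(Q)=(-1)^{|\{x\in Q:\mathfrak{t}(x)=-1\}|}$. **Rooted surjections.** $\mathcal{O}^*(P,\omega)$ is the set of rooted order-preserving surjections: surjective maps $f:P\to\{1,\dots,k\}$, for some $k$, such that $a<_P b$ implies $f(a)\le f(b)$, and such that each sub-poset $f^{-1}(i)$, with the order and labeling induced from $(P,\omega)$, is rooted. For such $f$, $\mathrm{wt}(f,d)$ is the composition $(\alpha_1,\dots,\alpha_k)$ with $\alpha_i=\sum_{a\in f^{-1}(i)}d(a)$. *)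

(* Defs.v *)
From HB Require Import structures.
From mathcomp Require Import all_boot all_order all_algebra finmap.
From mathcomp.multinomials Require Import monalg.
From mathcomp Require Import boolp classical_sets functions cardinality fsbigop.

Set Implicit Arguments.
Unset Strict Implicit.
Unset Printing Implicit Defensive.

Import Order.TTheory GRing.Theory Num.Theory.

Local Open Scope classical_set_scope.
Local Open Scope ring_scope.

Record pnat := PNat { pnat_val :> nat; _ : (0 < pnat_val)%N }.

HB.instance Definition _ := [isSub for pnat_val].
HB.instance Definition _ := [Choice of pnat by <:].

(** A series is its family of coefficients, indexed by the monomials in the
    variables x_i, i : pnat. *)
Notation fps := ({cmonom pnat} -> rat^o).

Definition fps_monom (m : {cmonom pnat}) : fps := fun m' => (m' == m)%:R.

Definition xpow (i : pnat) (e : nat) : {cmonom pnat} := expcmn (ucm i) e.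

(** Sum of a possibly infinite family of series, taken coefficientwise.  A
    coefficient to which infinitely many terms contribute would be set to 0;
    [finite_ppart_monom] and [finite_Mqsym_monom] below show that this does not
    happen for the families used here. *)
Definition fps_sum (I : choiceType) (A : set I) (F : I -> fps) : fps :=
  fun m => \sum_(i \in A) F i m.

Section PPartitions.
Context {disp : Order.disp_t} {P : finPOrderType disp} {n : nat}.
Implicit Types (w : P -> 'I_n) (d : P -> nat).

(** Labels are numbered from 0; only their relative order matters. *)
Definition is_ppartition w (f : {ffun P -> pnat}) : bool :=
  [forall a : P, forall b : P, (a < b)%O ==>
     (f a <= f b)%N &&
     ((w b < w a)%N ==> (f a < f b)%N)].

Definition ppart_monom d (f : {ffun P -> pnat}) : {cmonom pnat} :=
  \big[mmul/mone]_(a : P) xpow (f a) (d a).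

Definition Kgen w d : fps :=
  fps_sum [set f : {ffun P -> pnat} | is_ppartition w f]
          (fun f => fps_monom (ppart_monom d f)).

End PPartitions.

Definition is_composition (alpha : seq nat) : bool := all (ltn 0) alpha.

(** Finite, see [finite_compositions] below. *)
Definition compositions (N : nat) : set (seq nat) :=
  [set alpha | is_composition alpha /\ sumn alpha = N].

Definition Mqsym_monom (alpha : seq nat) (i : (size alpha).-tuple pnat) :
    {cmonom pnat} :=
  \big[mmul/mone]_(j < size alpha) xpow (tnth i j) (nth 0%N alpha j).

Definition Mqsym (alpha : seq nat) : fps :=
  fps_sum [set i : (size alpha).-tuple pnat |
             sorted (fun j k : pnat => (j < k)%N) i]
          (fun i => fps_monom (Mqsym_monom i)).

Definition is_blocks (alpha beta : seq nat) (bl : seq (seq nat)) : bool :=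
  [&& [::] \notin bl, flatten bl == alpha & map sumn bl == beta].

Definition refines (alpha beta : seq nat) : Prop :=
  exists bl, is_blocks alpha beta bl.

(** For compositions the block decomposition is unique, see
    [is_blocks_inj] below. *)
Definition blocks (alpha beta : seq nat) : seq (seq nat) :=
  xget [::] [set bl | is_blocks alpha beta bl].

Definition pi_refine (alpha beta : seq nat) : nat :=
  (\prod_(b <- blocks alpha beta) \prod_(1 <= j < (size b).+1) sumn (take j b))%N.

(** The sum is finite when alpha is a composition, see [finite_refines]. *)
Definition psihat (alpha : seq nat) : fps :=
  \sum_(beta \in [set beta | refines alpha beta])
     (pi_refine alpha beta)%:R^-1 *: Mqsym beta.

Variant lw_tag := TagNeg | TagStar | TagPos.

Lemma lw_tag_comparable : comparable lw_tag.
Proof. by move=> x y; rewrite /decidable; decide equality. Defined.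

HB.instance Definition _ := hasDecEq.Build lw_tag (compareP lw_tag_comparable).

(** A sub-poset of P is given by its set of elements Q, with the order and the
    labeling induced from P; its edges are the cover relations of the induced
    order, which need not be cover relations of P. *)
Section BorderStrips.
Context {disp : Order.disp_t} {P : finPOrderType disp} {n : nat}.
Variable w : P -> 'I_n.
Implicit Types (Q : {set P}) (a b x : P).

Definition is_edge Q a b : bool :=
  [&& a \in Q, b \in Q, (a < b)%O & ~~ [exists c in Q, (a < c)%O && (c < b)%O]].

Definition strict_edge Q a b : bool := is_edge Q a b && (w b < w a)%N.
Definition natural_edge Q a b : bool := is_edge Q a b && (w a < w b)%N.

Definition border_strip Q : bool :=
  ~~ [exists a in Q, exists b in Q, exists c in Q,
        [&& (a < b)%O, (b < c)%O, (w a < w b)%N & (w c < w b)%N]].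

(** The order of the first two tests is irrelevant on generalized border
    strips, see [lw_tagging_wf] below. *)
Definition lw_tagging Q x : lw_tag :=
  if [exists b, strict_edge Q x b] then TagNeg
  else if [exists a, natural_edge Q a x] then TagPos
  else TagStar.

Definition tagged Q (t : lw_tag) : {set P} := [set x in Q | lw_tagging Q x == t]%SET.

Definition is_rooted Q : bool := border_strip Q && (#|tagged Q TagStar| == 1%N).

(** [Some] of the root when Q is rooted. *)
Definition lw_root Q : option P := [pick x in tagged Q TagStar].

Definition lw_sgn Q : rat := (-1) ^+ #|tagged Q TagNeg|.

Definition weight_root (d : P -> nat) Q : nat := oapp d 0%N (lw_root Q).

Lemma lw_tagging_wf Q x : border_strip Q ->
  [exists b, strict_edge Q x b] -> ~~ [exists a, natural_edge Q a x].
Proof.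
move=> bsQ /existsP[c /andP[/and4P[xQ cQ ltxc _] wcx]].
apply: contraNN bsQ => /existsP[a /andP[/and4P[aQ _ ltax _] wax]].
by apply/exists_inP; exists a => //; apply/exists_inP; exists x => //;
  apply/exists_inP; exists c => //; rewrite ltax ltxc wax wcx.
Qed.

Lemma lw_root_rooted Q : is_rooted Q ->
  exists2 x, lw_root Q = Some x & tagged Q TagStar = [set x]%SET.
Proof.
move=> /andP[_ /cards1P[x Qx]]; exists x => //; rewrite /lw_root Qx.
by case: pickP => [y | /(_ x)]; rewrite inE ?eqxx // => /eqP ->.
Qed.

Section RootedSurjections.
Variable k : nat.
Implicit Type f : {ffun P -> 'I_k}.

Definition fiber f (i : 'I_k) : {set P} := [set a | f a == i]%SET.

Definition rooted_surj f : bool :=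
  [&& [forall i, exists a, f a == i],
      [forall a : P, forall b : P, (a < b)%O ==> (f a <= f b)%N]
    & [forall i, is_rooted (fiber f i)]].

(** wt f d has k parts, so that wt f d = alpha forces k = size alpha; sums over
    the rooted surjections f with wt f d = alpha, for arbitrary k, may thus be
    taken over the f : {ffun P -> 'I_(size alpha)}.  Values are numbered from 0. *)
Definition wt f (d : P -> nat) : seq nat :=
  [seq (\sum_(a in fiber f i) d a)%N | i <- enum 'I_k].

End RootedSurjections.
End BorderStrips.

Lemma xpowE i e j : xpow i e j = ((i == j) * e)%N.
Proof.
have step s : expcmn (ucm i) s.+1 = mmul (ucm i) (expcmn (ucm i) s).
  by case: s => [|s] //; rewrite /expcmn /= mulm1.
rewrite /xpow; elim: e => [|e IH]; first by rewrite muln0; exact: cm1.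
by rewrite step cmM IH cmU mulnS.
Qed.

Lemma big_xpowE (I : finType) (F : I -> pnat) (e : I -> nat) (j : pnat) :
  (\big[mmul/mone]_(a : I) xpow (F a) (e a)) j =
  (\sum_(a : I) (F a == j) * e a)%N.
Proof.
elim/big_rec2 : _ => [|a m y _ <-]; first by rewrite cm1.
by rewrite cmM xpowE.
Qed.

Lemma big_xpow_supp (I : finType) (F : I -> pnat) (e : I -> nat) (a : I) :
  (0 < e a)%N ->
  F a \in finsupp (cmonom_val (\big[mmul/mone]_(b : I) xpow (F b) (e b))).
Proof.
move=> ea; rewrite mem_finsupp big_xpowE (bigD1 a) //= eqxx mul1n.
by rewrite -lt0n addn_gt0 ea.
Qed.

Lemma finite_ppart_monom (disp : Order.disp_t) (P : finPOrderType disp)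
    (d : P -> nat) (m : {cmonom pnat}) : (forall a, (0 < d a)%N) ->
  finite_set [set f : {ffun P -> pnat} | ppart_monom d f = m].
Proof.
move=> d_gt0.
apply: (@sub_finite_set _ _
  ((fun g : {ffun P -> finsupp (cmonom_val m)} => [ffun a => val (g a)])
     @` setT)); last exact/finite_image/finite_finset.
move=> f /= fm.
have fin a : f a \in finsupp (cmonom_val m).
  by rewrite -fm; apply: big_xpow_supp.
by exists [ffun a => [` fin a]%fset] => //; apply/ffunP => a; rewrite !ffunE.
Qed.

Lemma finite_Mqsym_monom (alpha : seq nat) (m : {cmonom pnat}) :
  is_composition alpha ->
  finite_set [set i : (size alpha).-tuple pnat | Mqsym_monom i = m].
Proof.
move=> /(all_nthP 0%N) a_gt0.
apply: (@sub_finite_set _ _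
  ((fun g : (size alpha).-tuple (finsupp (cmonom_val m)) => map_tuple val g)
     @` setT)); last exact/finite_image/finite_finset.
move=> i /= im.
have fin j : tnth i j \in finsupp (cmonom_val m).
  rewrite -im; apply: (@big_xpow_supp _ (tnth i)
    (fun j : 'I_(size alpha) => nth 0%N alpha j)).
  exact: a_gt0.
exists [tuple [` fin j]%fset | j < size alpha] => //.
by apply/eq_from_tnth => j; rewrite tnth_map tnth_mktuple.
Qed.

Lemma finite_compositions N : finite_set (compositions N).
Proof.
apply: (@sub_finite_set _ _
  ((fun s : {bseq N of 'I_N.+1} => map val s) @` setT));
  last exact/finite_image/finite_finset.
move=> s /= [/allP s_gt0 sN].
have le_sN x : x \in s -> (x < N.+1)%N.
  by move=> xs; rewrite ltnS -sN sumnE (big_rem x) //= leq_addr.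
have szs : (size (map (inord : nat -> 'I_N.+1) s) <= N)%N.
  rewrite size_map -sN; elim: s s_gt0 {sN le_sN} => //= x s IH h.
  rewrite -add1n leq_add ?h ?mem_head // IH // => y ys.
  by apply: h; rewrite inE ys orbT.
exists (Bseq szs) => //=; rewrite -map_comp -[RHS]map_id.
by apply/eq_in_map => x /le_sN xN /=; rewrite inordK.
Qed.

Lemma refines_composition alpha beta : is_composition alpha ->
  refines alpha beta -> compositions (sumn alpha) beta.
Proof.
move=> ca [bl /and3P[nbl /eqP fa /eqP <-]]; move: ca; rewrite -{}fa.
rewrite /compositions /is_composition /=; elim: bl nbl => //= b bl IH.
rewrite inE negb_or sumn_cat => /andP[nb nbl].
rewrite all_cat => /andP[cb cbl].
have [-> ->] := IH nbl cbl; split; rewrite ?andbT //.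
by case: b nb cb => //= x b _ /andP[x0 _]; rewrite addn_gt0 x0.
Qed.

Lemma finite_refines alpha : is_composition alpha ->
  finite_set [set beta | refines alpha beta].
Proof.
move=> ca; apply: sub_finite_set (finite_compositions (sumn alpha)) => beta.
exact: refines_composition.
Qed.

Lemma is_blocks_inj alpha beta bl bl' : is_composition alpha ->
  is_blocks alpha beta bl -> is_blocks alpha beta bl' -> bl = bl'.
Proof.
have pref (s t u v : seq nat) : all (ltn 0) (s ++ u) -> all (ltn 0) (t ++ v) ->
    s ++ u = t ++ v -> sumn s = sumn t -> s = t.
  elim: s t => [|x s IH] [|y t] //=.
  - by move=> _ /andP[y0 _] _ /esym/eqP; rewrite addn_eq0 eqn0Ngt y0.
  - by move=> /andP[x0 _] _ _ /eqP; rewrite addn_eq0 eqn0Ngt x0.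
  by move=> /andP[_ h] /andP[_ h'] [<- e] /addnI e'; rewrite (IH t).
move=> ca /and3P[_ /eqP fa /eqP sb] /and3P[_ /eqP fa' /eqP sb'].
move: ca fa sb'; rewrite -fa' -{}sb => {fa' alpha beta}.
elim: bl bl' => [|b bl IH] [|b' bl'] //= ca fe [se1 se2].
have ca' : all (ltn 0) (b ++ flatten bl) by rewrite fe.
have eb := pref _ _ _ _ ca' ca fe (esym se1).
move: fe ca; rewrite eb => /eqP; rewrite eqseq_cat // eqxx /= => /eqP fe.
by rewrite /is_composition all_cat => /andP[_ ca]; rewrite (IH bl').
Qed.

(* Main.v *)
(** Both sides are compared at a monomial [m] with sorted exponents [mu].  On the
    left the coefficient counts the chains of downsets of P whose successive
    differences are naturally labeled, of weights [mu].  On the right, a rooted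
    surjection is such a chain with rooted differences, [M_beta] contributes
    exactly when [beta = mu], and grouping the parts of [alpha] into the blocks of
    [mu] reduces the claim to a single block: for every subset [Q] of total weight
    [m], the signed sum over rooted surjections of [Q], divided by the products of
    partial sums, is 1 or 0 according to whether [Q] is naturally labeled.
    Splitting off the last fiber and using induction, this amounts to
    [sum_D sgn (Q \ D) * [root (Q \ D) = x] = [Q natural]] for each [x] in [Q], the sum
    being over the naturally labeled downsets [D] of [Q] with rooted complement.  An
    element of a generalized border strip is tagged -1 (resp. +1) iff some larger
    (resp. smaller) element has a smaller label, so removing the element of largest
    label does not affect the other tags; toggling it proves the identity. *)
Require Import Defs.
From mathcomp Require Import all_boot all_order all_algebra finmap.
From mathcomp.multinomials Require Import monalg.
From mathcomp Require Import zify.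
From mathcomp Require Import boolp classical_sets functions cardinality fsbigop.
Set Implicit Arguments.
Unset Strict Implicit.
Unset Printing Implicit Defensive.
Import Order.TTheory GRing.Theory Num.Theory.
Local Open Scope ring_scope.

(** * Tags of generalized border strips expressed through labels *)

Section LabeledPoset.
Context {disp : Order.disp_t} {P : finPOrderType disp} {n : nat}.
Variable w : P -> 'I_n.
Hypothesis w_inj : injective w.
Implicit Types (Q R D : {set P}) (a b c x y z : P).

(** Ranges over all larger elements instead of covers, so that it does not depend on which elements
    of [R] lie in between. On border strips it is the tag -1, and [has_lower_below] the tag +1. *)
Definition has_lower_above R x : bool :=
  [exists c in R, (x < c)%O && (w c < w x)%N].

Definition has_lower_below R x : bool :=
  [exists a in R, (a < x)%O && (w a < w x)%N].

Lemma border_stripE R : border_strip w R =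
  [forall x in R, ~~ (has_lower_above R x && has_lower_below R x)].
Proof.
rewrite /border_strip; apply/idP/forall_inP => [bs x xR | h].
- apply: contraNN bs => /andP[/exists_inP[c cR /andP[xc wc]]].
  case/exists_inP=> a aR /andP[ax wa].
  apply/exists_inP; exists a => //; apply/exists_inP; exists x => //.
  by apply/exists_inP; exists c => //; rewrite ax xc wa wc.
- apply/negP => /exists_inP[a aR /exists_inP[b bR /exists_inP[c cR]]].
  case/and4P=> ab bc wab wcb; have /negP[] := h b bR.
  apply/andP; split; apply/exists_inP; first by exists c; rewrite ?bc.
  by exists a; rewrite ?ab.
Qed.

Lemma border_strip_chain R a b c : border_strip w R -> a \in R -> b \in R ->
  c \in R -> (a < b)%O -> (b < c)%O -> (w a < w b)%N -> (w c < w b)%N -> False.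
Proof.
move=> bs aR bR cR ab bc wab wcb; case/negP: bs.
apply/exists_inP; exists a => //; apply/exists_inP; exists b => //.
by apply/exists_inP; exists c => //; rewrite ab bc wab wcb.
Qed.

(** Among the elements above [x] with a smaller label, take one, [c], with the fewest elements below
    it. An [e] strictly between [x] and [c] contradicts minimality if its label is below that of
    [x], and otherwise is the peak of a forbidden chain. *)
Lemma strict_edgeE R x : border_strip w R -> x \in R ->
  [exists b, strict_edge w R x b] = has_lower_above R x.
Proof.
move=> bs xR; apply/existsP/exists_inP => [[b /andP[/and4P[_ bR xb _] wb]]|].
  by exists b => //; rewrite xb wb.
case=> c0 c0R h0; have Ac0 : (c0 \in R) && ((x < c0)%O && (w c0 < w x)%N).
  by rewrite c0R.
case: (@arg_minnP _ c0 (fun c => (c \in R) && ((x < c)%O && (w c < w x)%N))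
  (fun c => #|[set e | (e < c)%O]%SET|) Ac0).
move=> c /and3P[cR xc wc] cmin; exists c; rewrite /strict_edge wc andbT.
apply/and4P; split=> //; apply/negP => /exists_inP[e eR /andP[xe ec]].
have [we|we|/val_inj/w_inj exe] := ltngtP (w e) (w x).
- have := cmin e; rewrite eR xe we => /(_ isT); rewrite leqNgt => /negP[].
  apply: proper_card; apply/properP; split.
    by apply/fintype.subsetP => y; rewrite !inE => /lt_trans; apply.
  by exists e; rewrite inE ?ltxx.
- exact: (border_strip_chain bs xR eR cR xe ec we (ltn_trans wc we)).
- by rewrite exe ltxx in xe.
Qed.

(** Dual choice: a witness below [x] with the fewest elements above it. *)
Lemma natural_edgeE R x : border_strip w R -> x \in R ->
  [exists a, natural_edge w R a x] = has_lower_below R x.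
Proof.
move=> bs xR; apply/existsP/exists_inP => [[b /andP[/and4P[bR _ xb _] wb]]|].
  by exists b => //; rewrite xb wb.
case=> a0 a0R h0; have Aa0 : (a0 \in R) && ((a0 < x)%O && (w a0 < w x)%N).
  by rewrite a0R.
case: (@arg_minnP _ a0 (fun a => (a \in R) && ((a < x)%O && (w a < w x)%N))
  (fun a => #|[set e | (a < e)%O]%SET|) Aa0).
move=> a /and3P[aR ax wa] amin; exists a; rewrite /natural_edge wa andbT.
apply/and4P; split=> //; apply/negP => /exists_inP[e eR /andP[ae ex]].
have [we|we|/val_inj/w_inj exe] := ltngtP (w e) (w x).
- have := amin e; rewrite eR ex we => /(_ isT); rewrite leqNgt => /negP[].
  apply: proper_card; apply/properP; split.
    by apply/fintype.subsetP => y; rewrite !inE; apply: lt_trans.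
  by exists e; rewrite inE ?ltxx.
- exact: (border_strip_chain bs aR eR xR ae ex (ltn_trans wa we) we).
- by rewrite exe ltxx in ex.
Qed.

(** The exclusive or says at once that [y] is not the peak of a forbidden chain and that it is not
    tagged [TagStar]. *)
Definition rooted_at R x : bool :=
  [&& x \in R, ~~ has_lower_above R x, ~~ has_lower_below R x &
   [forall y in R, (y != x) ==> (has_lower_above R y (+) has_lower_below R y)]].

Definition neg_sign R : rat := (-1) ^+ #|[set y in R | has_lower_above R y]%SET|.

Lemma tagged_starE R : border_strip w R -> Defs.tagged w R TagStar =
  [set y in R | ~~ has_lower_above R y && ~~ has_lower_below R y]%SET.
Proof.
move=> bs; apply/finset.setP => y; rewrite !inE; case: (boolP (y \in R)) => //= yR.
rewrite /lw_tagging strict_edgeE // natural_edgeE //.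
by case: has_lower_above => //; case: has_lower_below.
Qed.

Lemma lw_sgnE R : border_strip w R -> lw_sgn w R = neg_sign R.
Proof.
move=> bs; rewrite /lw_sgn /neg_sign; congr (_ ^+ _); apply: eq_card => y.
rewrite !inE; case: (boolP (y \in R)) => //= yR.
rewrite /lw_tagging strict_edgeE //.
by case: has_lower_above => //; case: ifP.
Qed.

Lemma rooted_atP R x :
  reflect (border_strip w R /\ Defs.tagged w R TagStar = [set x]%SET) (rooted_at R x).
Proof.
apply: (iffP and4P) => [[xR nx px /forall_inP h]|[bs Rx]].
- have bs : border_strip w R.
    rewrite border_stripE; apply/forall_inP => y yR.
    have [->|yx] := eqVneq y x; first by rewrite (negPf nx).
    by have := h y yR; rewrite yx /=; do 2!case: has_lower_above has_lower_below.
  split=> //; rewrite tagged_starE //; apply/finset.setP => y; rewrite !inE.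
  have [->|yx] := eqVneq y x; first by rewrite xR nx px.
  case: (boolP (y \in R)) => //= yR; have := h y yR; rewrite yx /=.
  by case: has_lower_above => //; case: has_lower_below.
- move: Rx; rewrite tagged_starE // => /finset.setP Rx.
  have := Rx x; rewrite !inE eqxx => /and3P[xR nx px]; split=> //.
  apply/forall_inP => y yR; apply/implyP => /negPf yx; have := Rx y.
  rewrite !inE yR yx /=; move: bs; rewrite border_stripE => /forall_inP/(_ y yR).
  by case: has_lower_above => //; case: has_lower_below.
Qed.

(** At most one [x] is a root, so the sum has at most one nonzero term. Written this way, the weight
    of the root can be exchanged with sums over sets. *)
Lemma rooted_weightE (d : P -> nat) R :
  (if is_rooted w R then lw_sgn w R * (weight_root w d R)%:R else 0) =
  \sum_x (if rooted_at R x then neg_sign R * (d x)%:R else 0).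
Proof.
rewrite -big_mkcond; case: ifP => [rR | /negP nR]; last first.
  rewrite big_pred0 // => x; apply/negP => /rooted_atP[bs Rx]; apply: nR.
  by rewrite /is_rooted bs Rx cards1.
have [x rx Rx] := lw_root_rooted rR; have /andP[bs _] := rR.
rewrite (big_pred1 x) => [|y]; first by rewrite /weight_root rx lw_sgnE.
apply/rooted_atP/eqP => [[_]|->] //; rewrite Rx => /finset.setP/(_ x).
by rewrite !inE eqxx => /esym/eqP.
Qed.

(** * Naturally labeled subsets and downsets *)

Definition natural R : bool :=
  [forall a in R, forall b in R, (a < b)%O ==> (w a < w b)%N].

Definition downset Q D : bool :=
  (D \subset Q) && [forall a in Q, forall b in D, (a < b)%O ==> (a \in D)].

Lemma naturalP R :
  reflect {in R &, forall a b, (a < b)%O -> (w a < w b)%N} (natural R).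
Proof.
apply: (iffP forall_inP) => [h a b aR bR | h a aR].
  by have /forall_inP/(_ b bR)/implyP := h a aR.
by apply/forall_inP => b bR; apply/implyP; apply: h.
Qed.

Lemma downsetP Q D :
  reflect (D \subset Q /\ forall a b, a \in Q -> b \in D -> (a < b)%O -> a \in D)
          (downset Q D).
Proof.
apply: (iffP andP) => -[sDQ h]; split=> //.
  by move=> a b aQ bD; have /forall_inP/(_ a aQ)/forall_inP/(_ b bD)/implyP := h.
apply/forall_inP => a aQ; apply/forall_inP => b bD; apply/implyP.
exact: h.
Qed.

(** * Adjoining an element of largest label *)

Section MaxLabel.
Variables (Q : {set P}) (z : P).
Hypotheses (zQ : z \in Q) (zmax : {in Q, forall y, (w y <= w z)%N}).

Let ltz y : y \in Q -> y != z -> (w y < w z)%N.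
Proof.
move=> yQ yz; rewrite ltn_neqAle zmax // andbT.
by apply: contra yz => /eqP/val_inj/w_inj ->.
Qed.

Variable R : {set P}.
Hypothesis sRQ : R \subset Q :\ z.

Let zNR : z \notin R.
Proof. by apply/negP => /(fintype.subsetP sRQ); rewrite !inE eqxx. Qed.

Let RQ y : y \in R -> (y \in Q) /\ (y != z).
Proof. by move/(fintype.subsetP sRQ); rewrite !inE => /andP[]. Qed.

(** The new element [z] is never a witness, since its label is not smaller than that of [y]. *)
Lemma lower_above_add_max y : y \in R ->
  has_lower_above (z |: R) y = has_lower_above R y.
Proof.
move=> yR; have [yQ yz] := RQ yR.
apply/exists_inP/exists_inP => -[c cR h]; exists c => //; last first.
  by rewrite !inE cR orbT.
move: cR; rewrite !inE => /orP[/eqP cz|//].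
by move: h; rewrite cz ltnNge zmax ?andbF.
Qed.

Lemma lower_below_add_max y : y \in R ->
  has_lower_below (z |: R) y = has_lower_below R y.
Proof.
move=> yR; have [yQ yz] := RQ yR.
apply/exists_inP/exists_inP => -[c cR h]; exists c => //; last first.
  by rewrite !inE cR orbT.
move: cR; rewrite !inE => /orP[/eqP cz|//].
by move: h; rewrite cz ltnNge zmax ?andbF.
Qed.

Lemma lower_above_max : has_lower_above (z |: R) z = [exists c in R, (z < c)%O].
Proof.
apply/exists_inP/exists_inP => -[c cR h]; exists c.
- by move: cR h; rewrite !inE => /orP[/eqP->|//]; rewrite ltxx.
- by case/andP: h.
- by rewrite !inE cR orbT.
- by have [cQ cz] := RQ cR; rewrite h ltz.
Qed.

Lemma lower_below_max : has_lower_below (z |: R) z = [exists a in R, (a < z)%O].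
Proof.
apply/exists_inP/exists_inP => -[c cR h]; exists c.
- by move: cR h; rewrite !inE => /orP[/eqP->|//]; rewrite ltxx.
- by case/andP: h.
- by rewrite !inE cR orbT.
- by have [cQ cz] := RQ cR; rewrite h ltz.
Qed.

Lemma rooted_at_add_max x : x != z -> rooted_at (z |: R) x =
  rooted_at R x && ([exists c in R, (z < c)%O] (+) [exists a in R, (a < z)%O]).
Proof.
move=> xz; rewrite -lower_above_max -lower_below_max.
rewrite /rooted_at !inE (negPf xz) /=; case: (boolP (x \in R)) => //= xR.
rewrite lower_above_add_max // lower_below_add_max // -!andbA; do 2!congr (_ && _).
apply/forall_inP/andP => [h|[/forall_inP h hz] y].
- split; last by have := h z; rewrite !inE eqxx eq_sym xz => /(_ isT).
  apply/forall_inP => y yR; have := h y; rewrite !inE yR orbT => /(_ isT).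
  by rewrite lower_above_add_max // lower_below_add_max.
- rewrite !inE => /orP[/eqP->|yR]; first by rewrite hz implybT.
  by rewrite lower_above_add_max // lower_below_add_max //; apply: h.
Qed.

(** If [R] is nonempty, its element of smallest label has neither kind of witness and would be a
    second root. *)
Lemma rooted_at_max : rooted_at (z |: R) z = (R == finset.set0).
Proof.
apply/idP/eqP => [/and4P[_ _ _ /forall_inP h]|->].
- apply/eqP; apply: contraT => /set0Pn[y0 y0R].
  case: (@arg_minnP _ y0 [in R] (fun y => w y : nat) y0R) => y yR ymin.
  have := h y; rewrite !inE yR orbT => /(_ isT).
  have [_ ->] := RQ yR; rewrite lower_above_add_max // lower_below_add_max //=.
  have /negPf-> : ~~ has_lower_above R y.
    by apply/exists_inP => -[c cR /andP[_]]; rewrite ltnNge ymin.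
  have /negPf-> // : ~~ has_lower_below R y.
  by apply/exists_inP => -[c cR /andP[_]]; rewrite ltnNge ymin.
- rewrite /rooted_at !inE eqxx /=; apply/and3P; split.
  + by apply/exists_inP => -[c]; rewrite !inE orbF => /eqP->; rewrite ltxx.
  + by apply/exists_inP => -[c]; rewrite !inE orbF => /eqP->; rewrite ltxx.
  + by apply/forall_inP => y; rewrite !inE orbF => ->.
Qed.

Lemma neg_sign_add_max : neg_sign (z |: R) =
  neg_sign R * (-1) ^+ [exists c in R, (z < c)%O].
Proof.
rewrite /neg_sign -exprD; congr (_ ^+ _).
rewrite -lower_above_max addnC (cardsD1 z) !inE eqxx /=; congr (_ + _)%N.
apply: eq_card => y; rewrite !inE; have [->|yz] /= := eqVneq y z.
  by rewrite (negPf zNR).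
by case: (boolP (y \in R)) => //= yR; rewrite lower_above_add_max.
Qed.

Lemma natural_add_max :
  natural (z |: R) = natural R && ~~ [exists b in R, (z < b)%O].
Proof.
apply/naturalP/andP => [h|[/naturalP h nb] a b].
- split; first by apply/naturalP => a b aR bR; apply: h; rewrite !inE ?aR ?bR orbT.
  apply/exists_inP => -[b bR zb]; have := h z b; rewrite !inE eqxx bR orbT.
  by move=> /(_ isT isT zb); rewrite ltnNge zmax //; case: (RQ bR).
- rewrite !inE => /orP[/eqP->|aR] /orP[/eqP->|bR]; first by rewrite ltxx.
  + by move=> zb; case/negP: nb; apply/exists_inP; exists b.
  + by move=> _; have [aQ az] := RQ aR; apply: ltz.
  + exact: h.
Qed.

End MaxLabel.

(** * The signed sum over downsets whose complement has a prescribed root *)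

Definition root_term Q x D : rat :=
  if [&& downset Q D, natural D & rooted_at (Q :\: D) x]
  then neg_sign (Q :\: D) else 0.

Lemma downset_remove Q D z : z \in Q -> D \subset Q :\ z ->
  downset Q D = downset (Q :\ z) D && ~~ [exists b in D, (z < b)%O].
Proof.
move=> zQ sD; have zD : z \notin D.
  by apply/negP => /(fintype.subsetP sD); rewrite !inE eqxx.
apply/downsetP/andP => [[sDQ h]|[/downsetP[_ h] nb]].
- split; first apply/downsetP; first split=> // a b.
    by rewrite !inE => /andP[_]; apply: h.
  by apply/exists_inP => -[b bD zb]; rewrite (h z b) in zD.
- split=> [|a b aQ bD ab].
    apply: fintype.subset_trans sD _.
    by apply/fintype.subsetP => y; rewrite !inE => /andP[].
  apply: (h a b) => //; rewrite !inE aQ andbT.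
  apply: contraNneq nb => az; apply/exists_inP; exists b => //.
  by rewrite -az.
Qed.

Lemma downset_add Q D z : z \in Q -> D \subset Q :\ z ->
  downset Q (z |: D) =
  downset (Q :\ z) D && ~~ [exists a in Q :\ z :\: D, (a < z)%O].
Proof.
move=> zQ sD; apply/downsetP/andP => [[sDQ h]|[/downsetP[_ h] nb]].
- split; first apply/downsetP; first split=> // a b.
    rewrite !inE => /andP[/negPf az aQ] bD ab; have := h a b aQ.
    by rewrite !inE bD orbT az => /(_ isT ab).
  apply/exists_inP => -[a]; rewrite !inE => /and3P[aD az aQ] alt.
  have := h a z aQ; rewrite !inE eqxx => /(_ isT alt).
  by rewrite (negPf az) (negPf aD).
- split.
    apply/fintype.subsetP => y; rewrite !inE => /orP[/eqP->//|/(fintype.subsetP sD)].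
    by rewrite !inE => /andP[].
  move=> a b aQ; rewrite !inE; have [//|az /=] := eqVneq a z.
  case/orP=> [/eqP->|bD] ab; last by apply: (h a b); rewrite // !inE az.
  apply: contraNT nb => aD; apply/exists_inP; exists a => //.
  by rewrite !inE aD az aQ.
Qed.

(** Pairs each [D] avoiding [z] with [z |: D], so that toggling [z] acts inside a single summand. *)
Lemma sum_subset_split (V : nmodType) Q z (F : {set P} -> V) : z \in Q ->
  \sum_(D : {set P} | D \subset Q) F D =
  \sum_(D : {set P} | D \subset Q :\ z) (F D + F (z |: D)).
Proof.
move=> zQ; rewrite big_split /= (bigID (fun D : {set P} => z \in D)) /= addrC.
congr (_ + _).
  by apply: eq_bigl => D; rewrite finset.subsetD1.
rewrite (reindex_onto (fun D => z |: D) (fun D => D :\ z)) /=; last first.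
  by move=> D /andP[_ zD]; rewrite finset.setD1K.
apply: eq_bigl => D; rewrite !inE eqxx andbT finset.subsetD1.
rewrite finset.subUset finset.sub1set zQ /=; case: (boolP (z \in D)) => [zD|zD].
  by rewrite andbF; apply/negbTE/nandP; right; apply: contraL zD => /eqP<-;
     rewrite !inE eqxx.
by rewrite finset.setU1K // eqxx.
Qed.

(** Deleting the element z of largest label leaves the tags of all other elements
    unchanged.  If z is not maximal in Q, moving z between D and its complement
    reverses the sign; otherwise exactly one of D, z |: D survives and the sum
    for Q reduces to the sum for Q :\ z. *)
Lemma sum_root_term Q x : x \in Q ->
  \sum_(D : {set P} | D \subset Q) root_term Q x D = (natural Q)%:R.
Proof.
have [k] := ubnP #|Q|; elim: k => // k IH in Q * => ltQk xQ.
case: (@arg_maxnP _ x [in Q] (fun y => w y : nat) xQ) => z zQ zmax.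
have eRz D : Q :\: (z |: D) = Q :\ z :\: D.
  by apply/finset.setP => y; rewrite !inE negb_or -andbA andbCA.
have eR D : D \subset Q :\ z -> Q :\: D = z |: (Q :\ z :\: D).
  move=> sD; apply/finset.setP => y; rewrite !inE.
  have [->|//] := eqVneq y z; rewrite zQ andbT.
  by apply/negP => /(fintype.subsetP sD); rewrite !inE eqxx.
have sR D : Q :\ z :\: D \subset Q :\ z by apply: finset.subsetDl.
have natQ : natural Q =
    natural (Q :\ z) && ~~ [exists b in Q :\ z, (z < b)%O].
  by rewrite -(natural_add_max zmax) // finset.setD1K.
rewrite (sum_subset_split _ zQ).
have [exz|xz] := eqVneq x z.
  (* A root [z] forces the complement of [D] to be [z] alone by [rooted_at_max]. Hence only
     [D = Q :\ z] contributes, with sign +1, precisely when [Q] is natural. *)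
  subst x; rewrite (bigD1 (Q :\ z)) //= big1 ?addr0 => [|D /andP[sD neD]].
    rewrite /root_term eRz // (eR (Q :\ z)) // finset.setDv.
    rewrite (rooted_at_max zmax) ?finset.sub0set //.
    rewrite eqxx andbT /rooted_at finset.in_set0 /= !andbF addr0.
    rewrite /neg_sign (downset_remove zQ) // natQ.
    have -> : downset (Q :\ z) (Q :\ z) by apply/downsetP.
    rewrite andTb andbC; case: ifP => // _.
    rewrite eq_card0 => [|y]; first by [].
    rewrite !inE; apply/negP.
    case/andP=> /orP[/eqP->|//] /exists_inP[c]; rewrite !inE orbF => /eqP->.
    by rewrite ltxx.
  rewrite /root_term eRz (eR _ sD) (rooted_at_max zmax) //.
  rewrite /rooted_at !inE eqxx /= !andbF /= addr0.
  case: eqP; rewrite ?andbF // => /eqP; rewrite finset.setD_eq0 => sD'.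
  by case/eqP: neD; apply/eqP; rewrite finset.eqEsubset sD.
have xQz : x \in Q :\ z by rewrite !inE xz.
have ltk : (#|Q :\ z| < k)%N by move: ltQk; rewrite (cardsD1 z) zQ.
have E D : D \subset Q :\ z -> root_term Q x D + root_term Q x (z |: D) =
   if [exists e in Q, (z < e)%O] then 0 else root_term (Q :\ z) x D.
  move=> sD; rewrite /root_term eRz (eR _ sD).
  rewrite (downset_remove zQ) // downset_add // (natural_add_max zmax sD).
  rewrite (rooted_at_add_max zmax) // (neg_sign_add_max zmax) //.
  case: (downset _ _) => /=; last by rewrite addr0 if_same.
  case: (natural D) => /=; last by rewrite !andbF addr0 if_same.
  case: (rooted_at _ _) => /=; last by rewrite !andbF addr0 if_same.
  rewrite !andbT.
  set N := [exists c in Q :\ z :\: D, (z < c)%O].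
  set A := [exists c in D, (z < c)%O].
  set S := [exists e in Q, (z < e)%O]; set L := [exists a in Q :\ z :\: D, (a < z)%O].
  have -> : S = N || A.
    apply/exists_inP/orP => [[e eQ' ze]|[]/exists_inP[e]].
    - case: (boolP (e \in D)) => eD; [right|left]; apply/exists_inP; exists e => //.
      by rewrite !inE eD eQ' andbT; apply: contraTneq ze => ->; rewrite ltxx.
    - by rewrite !inE => /and3P[_ _ eQ'] ze; exists e.
    - by move/(fintype.subsetP sD); rewrite !inE => /andP[_ eQ'] ze; exists e.
  (* If [A] holds, both terms vanish. If only [N] among [A] and [N] holds, both vanish under [L] and
     they cancel otherwise. If neither holds, the first term survives under [L] and the second one
     otherwise. *)
  case: A; case: N; case: L; rewrite /= ?mulr1 ?addr0 ?add0r ?mulrN1 //.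
  by rewrite addNr.
rewrite (eq_bigr _ E) natQ.
have -> : [exists e in Q, (z < e)%O] = [exists e in Q :\ z, (z < e)%O].
  apply/exists_inP/exists_inP => -[e eQ' ze]; exists e => //.
    by rewrite !inE eQ' andbT; apply: contraTneq ze => ->; rewrite ltxx.
  by move: eQ'; rewrite !inE => /andP[].
case: [exists _ in _, _]; first by rewrite andbF big1.
by rewrite andbT IH.
Qed.

End LabeledPoset.

(** * Sums over chains of downsets *)

Section ChainSums.
Context {disp : Order.disp_t} {P : finPOrderType disp} {n : nat}.
Variable w : P -> 'I_n.
Hypothesis w_inj : injective w.
Variable d : P -> nat.
Hypothesis d_gt0 : forall a, (0 < d a)%N.
Implicit Types (Q R D : {set P}) (a b c x y z : P).

Definition weight R : nat := (\sum_(a in R) d a)%N.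

Definition root_weight R : rat :=
  if is_rooted w R then lw_sgn w R * (weight_root w d R)%:R else 0.

Lemma weight_eq0 R : (weight R == 0%N) = (R == finset.set0).
Proof.
rewrite /weight sum_nat_eq0; apply/forall_inP/eqP => [h|-> a]; last by rewrite inE.
apply/finset.setP => a; rewrite inE; apply/negP => /h.
by rewrite eqn0Ngt d_gt0.
Qed.

Lemma root_weight0 : root_weight finset.set0 = 0.
Proof.
rewrite /root_weight /is_rooted; case: ifP => // /andP[_].
by rewrite eq_card0 // => y; rewrite !inE.
Qed.

(** Sort the terms by their root [x]: by [sum_root_term] each [x] in [Q] contributes [d x] if [Q] is
    natural and 0 otherwise. *)
Lemma sum_root_weight Q :
  \sum_(D | downset Q D) (natural w D)%:R * root_weight (Q :\: D) =
  (natural w Q)%:R * (weight Q)%:R.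
Proof.
transitivity (\sum_(D : {set P} | D \subset Q)
    \sum_(x in Q) root_term w Q x D * (d x)%:R).
  rewrite [LHS]big_mkcond [RHS]big_mkcond; apply: eq_bigr => D _.
  rewrite /root_weight rooted_weightE // /root_term.
  case: (boolP (downset Q D)) => [|_] /=; last first.
    by case: ifP => // _; rewrite big1 // => x _; rewrite mul0r.
  move=> /andP[-> _]; case: (natural w D); last first.
    by rewrite mul0r big1 // => x _; rewrite mul0r.
  rewrite mul1r [RHS]big_mkcond; apply: eq_bigr => x _ /=.
  case: ifP => [/andP[]|_]; last by rewrite mul0r if_same.
  by rewrite inE => /andP[_ ->].
rewrite exchange_big /= /weight natr_sum mulr_sumr; apply: eq_bigr => x xQ.
by rewrite -mulr_suml sum_root_term.
Qed.

(** An iterated convolution: the sum over chains of downsets from the empty set to [Q], with [phis]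
    evaluated at the successive differences, which may be empty. *)
Fixpoint chain_sum (phis : seq ({set P} -> rat)) Q : rat :=
  if phis is phi :: phis' then
    \sum_(D | downset Q D) phi D * chain_sum phis' (Q :\: D)
  else (Q == finset.set0)%:R.

Lemma chain_sum1 phi Q : chain_sum [:: phi] Q = phi Q.
Proof.
have dQ : downset Q Q by apply/downsetP.
rewrite /= (bigD1 Q) //= finset.setDv eqxx mulr1 big1 ?addr0 //.
move=> D /andP[/andP[sDQ _] neD]; case: eqP => [|_]; last by rewrite mulr0.
by move/eqP; rewrite finset.setD_eq0 => sQD; rewrite finset.eqEsubset sDQ sQD in neD.
Qed.

(** Downsets of [Q :\: D] correspond to downsets of [Q] in which [D] is a downset. The left side is
    shaped as the reindexing condition needed in [chain_sum_cat]. *)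
Lemma downset_setU Q D E : downset Q D ->
  [&& downset Q (D :|: E), downset (D :|: E) D & (D :|: E) :\: D == E] =
  downset (Q :\: D) E.
Proof.
move=> /downsetP[sDQ hD]; apply/and3P/downsetP => [[]|[sE hE]].
  move=> /downsetP[sU hU] /downsetP[_ hDU] /eqP eE; split.
    by rewrite -eE finset.setSD.
  move=> a b; rewrite inE => /andP[aD aQ] bE ab.
  have := hU a b aQ; rewrite !inE bE orbT (negPf aD); exact.
have sEQ : E \subset Q by apply: fintype.subset_trans sE (finset.subsetDl _ _).
split.
- apply/downsetP; split; first by rewrite finset.subUset sDQ.
  move=> a b aQ; rewrite !inE => /orP[bD|bE] ab; first by rewrite (hD a b).
  by have [//|aD] := boolP (a \in D); apply: (hE a b); rewrite // inE aD.
- apply/downsetP; split; first exact: finset.subsetUl.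
  move=> a b; rewrite !inE => /orP[//|/(fintype.subsetP sEQ) aQ] bD ab.
  exact: (hD a b).
- apply/eqP/finset.setP => y; rewrite !inE.
  case: (boolP (y \in D)) => //= yD; apply/esym/negP.
  by move/(fintype.subsetP sE); rewrite inE yD.
Qed.

(** Associativity of the convolution: choosing [E] and then [D] inside it amounts to choosing [D]
    and then [E :\: D] inside [Q :\: D]. *)
Lemma chain_sum_cat phis psis Q : chain_sum (phis ++ psis) Q =
  \sum_(E | downset Q E) chain_sum phis E * chain_sum psis (Q :\: E).
Proof.
elim: phis Q => [|phi phis IH] Q /=.
  have d0 : downset Q finset.set0.
    by apply/downsetP; split; rewrite ?finset.sub0set // => a b _; rewrite inE.
  rewrite (bigD1 finset.set0) //= eqxx mul1r finset.setD0 big1 ?addr0 //.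
  by move=> E /andP[_ /negPf->]; rewrite mul0r.
under [RHS]eq_bigr => E _ do rewrite big_distrl /=.
rewrite (exchange_big_dep (downset Q)) /=; last first.
  move=> E D /downsetP[sEQ hE] /downsetP[sDE hD]; apply/downsetP; split.
    exact: fintype.subset_trans sDE sEQ.
  move=> a b aQ bD ab; apply: (hD a b) => //; apply: (hE a b) => //.
  exact: (fintype.subsetP sDE).
apply: eq_bigr => D dD; rewrite IH mulr_sumr.
rewrite [RHS](reindex_onto (fun E => D :|: E) (fun E => E :\: D)) /=; last first.
  move=> E /andP[_ /downsetP[sDE _]]; apply/finset.setP => y; rewrite !inE.
  by case: (boolP (y \in D)) => // /(fintype.subsetP sDE) ->.
apply: eq_big => [E|E dE]; first by rewrite -(downset_setU E dD) andbA.
have := dE; rewrite -(downset_setU E dD) => /and3P[_ _ /eqP ->].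
rewrite mulrA; congr (_ * chain_sum _ _).
by apply/finset.setP => y; rewrite !inE negb_or andbA [~~ _ && ~~ _]andbC.
Qed.

(** * Compositions of one block, and refinements block by block *)

Definition rooted_part r R : rat := if weight R == r then root_weight R else 0.

Definition natural_part r R : rat := (natural w R && (weight R == r))%:R.

(** The factor of [pi_refine] contributed by one block. *)
Definition prefix_prod (s : seq nat) : nat :=
  (\prod_(1 <= j < (size s).+1) sumn (take j s))%N.

(** Here [k] is fuel, sufficient as soon as [m <= k]. The last part is chosen first because
    [sum_comps] splits off the last fiber. *)
Fixpoint comps (k m : nat) : seq (seq nat) :=
  if m is 0 then [:: [::]] else
  if k is k'.+1 then [seq rcons s r | r <- iota 1 m, s <- comps k' (m - r)]
  else [::].

Lemma compsS k m : comps k.+1 m.+1 =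
  [seq rcons s r | r <- iota 1 m.+1, s <- comps k (m.+1 - r)].
Proof. by []. Qed.

Lemma mem_comps k m s : (m <= k)%N ->
  (s \in comps k m) = is_composition s && (sumn s == m).
Proof.
have base t : (t \in [:: [::]]) = is_composition t && (sumn t == 0%N).
  by rewrite inE; case: t => [|[|x] t] //=; rewrite andbF.
elim: k m s => [|k IH] [|m] s // lemk; try exact: base.
rewrite compsS.
apply/allpairsPdep/andP => [[r [t []]]|].
  rewrite mem_iota add1n ltnS => /andP[r0 rm]; rewrite IH; last first.
    by move: r0 rm lemk; clear; lia.
  move=> /andP[ct /eqP st] ->; rewrite /is_composition all_rcons sumn_rcons st.
  by rewrite subnK //; split=> //; apply/andP.
case/lastP: s => [|s r] [//]; rewrite /is_composition all_rcons sumn_rcons.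
move=> /andP[/= r0 cs] /eqP e; exists r, s; split; last by [].
  by rewrite -[_ :: _]/(iota 1 m.+1) mem_iota r0 -e; clear; lia.
by rewrite IH /is_composition ?cs -?e ?addnK //; move: e r0 lemk; clear; lia.
Qed.

Lemma comps_uniq k m : uniq (comps k m).
Proof.
elim: k m => [|k IH] [|m] //; rewrite compsS.
apply: allpairs_uniq_dep => [|r _|]; [exact: (iota_uniq 1 m.+1)|exact: IH|].
by move=> [r s] [r' s'] _ _ /= /rcons_inj[-> ->].
Qed.

Lemma prefix_prod_rcons s r :
  prefix_prod (rcons s r) = (prefix_prod s * (sumn s + r))%N.
Proof.
rewrite /prefix_prod size_rcons big_nat_recr //= take_oversize ?size_rcons //.
rewrite sumn_rcons; congr (_ * _)%N; apply: eq_big_nat => j /andP[_ lej].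
by rewrite -cats1 takel_cat.
Qed.

(** Grouping by the last part [r]: the top fiber [Q :\: D] is rooted of weight
    [r], and the last factor of [prefix_prod] is the total weight [m], which
    [sum_root_weight] cancels. *)
Lemma sum_comps k m Q : (m <= k)%N ->
  \sum_(s <- comps k m)
     (prefix_prod s)%:R^-1 * chain_sum [seq rooted_part r | r <- s] Q =
  natural_part m Q.
Proof.
have base R : \sum_(s <- [:: [::]])
     (prefix_prod s)%:R^-1 * chain_sum [seq rooted_part r | r <- s] R =
  natural_part 0 R.
  rewrite big_seq1 /prefix_prod big_geq //= invr1 mul1r /natural_part.
  rewrite weight_eq0; case: eqP => [->|]; last by rewrite andbF.
  rewrite andbT; have -> // : natural w finset.set0.
  by apply/naturalP => a b; rewrite inE.
elim: k m Q => [|k IH] [|m] Q // lemk; try exact: base.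
rewrite compsS big_allpairs_dep.
transitivity (m.+1%:R^-1 * \sum_(D | downset Q D) \sum_(r <- iota 1 m.+1)
    rooted_part r (Q :\: D) * natural_part (m.+1 - r)%N D).
  rewrite exchange_big mulr_sumr; apply: eq_big_seq => r.
  rewrite mem_iota add1n => /andP[r0]; rewrite ltnS => rm.
  have lek : (m.+1 - r <= k)%N by lia.
  under [in RHS]eq_bigr => D _ do rewrite -IH // mulr_sumr.
  rewrite exchange_big /= mulr_sumr; apply: eq_big_seq => s.
  rewrite mem_comps // => /andP[_ /eqP es].
  rewrite prefix_prod_rcons es subnK // natrM invfM map_rcons -cats1 chain_sum_cat.
  rewrite !mulr_sumr; apply: eq_bigr => D _; rewrite chain_sum1.
  by rewrite [_^-1 * _]mulrC -mulrA; congr (_ * _); rewrite [RHS]mulrC mulrA.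
(* Only [r = weight (Q :\: D)] contributes, and for it the condition on the weight of [D] becomes
   one on the weight of [Q], independent of [D]. *)
transitivity (m.+1%:R^-1 * \sum_(D | downset Q D)
   (weight Q == m.+1)%:R * ((natural w D)%:R * root_weight (Q :\: D))).
  congr (_ * _); apply: eq_bigr => D /andP[sDQ _].
  have eQ : weight Q = (weight D + weight (Q :\: D))%N.
    by rewrite /weight (big_setID D) /= (finset.setIidPr sDQ).
  rewrite /rooted_part /natural_part.
  (* The range of [r] starts at 1. This loses nothing, since an empty complement has no root and
     [root_weight] is 0 there. *)
  have [/eqP|neq0] := eqVneq (weight (Q :\: D)) 0%N.
    rewrite weight_eq0 => /eqP->; rewrite root_weight0 !mulr0 big1 // => r _.
    by rewrite if_same mul0r.
  case: (leqP (weight (Q :\: D)) m.+1) => lem.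
    rewrite (bigD1_seq (weight (Q :\: D))) ?iota_uniq //; last first.
      by rewrite mem_iota; lia.
    rewrite eqxx big1 => [|r /negPf ne]; last first.
      by rewrite eq_sym ne mul0r.
    rewrite /= addr0 mulrC mulrA; congr (_ * _); rewrite -natrM mulnb andbC.
    by congr (_ && _)%:R; apply/eqP/eqP; lia.
  rewrite big_seq big1 => [|r]; last first.
    by rewrite mem_iota => hr; rewrite gtn_eqF ?mul0r //; lia.
  by rewrite gtn_eqF ?mul0r // eQ; lia.
rewrite -mulr_sumr sum_root_weight /natural_part.
case: eqP => [->|_]; last by rewrite mul0r mulr0 andbF.
by rewrite mul1r andbT mulrCA mulVf ?mulr1 // pnatr_eq0.
Qed.

(** Lists block decompositions; [flatten] recovers the refinements. Sums over this list factor over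
    the parts of [mu]. *)
Fixpoint refinements (mu : seq nat) : seq (seq (seq nat)) :=
  if mu is m :: mu' then [seq s :: bl | s <- comps m m, bl <- refinements mu']
  else [:: [::]].

Lemma mem_refinements mu bl :
  (bl \in refinements mu) = all is_composition bl && (map sumn bl == mu).
Proof.
elim: mu bl => [|m mu IH] bl /=.
  by rewrite inE; case: bl => // b bl; rewrite andbF.
apply/allpairsP/idP => [[[s t] /= [ss tt ->]]|].
  move: ss tt; rewrite IH mem_comps // => /andP[cs /eqP <-] /andP[/= -> /eqP <-].
  by rewrite /= cs eqxx.
case: bl => [|s t]; rewrite ?andbF //= eqseq_cons -!andbA => /and4P[cs ct es et].
exists (s, t); split => //=; first by rewrite mem_comps ?leqnn // cs.
by rewrite IH ct.
Qed.

Lemma refinements_uniq mu : uniq (refinements mu).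
Proof.
elim: mu => //= m mu IH; apply: allpairs_uniq => //; first exact: comps_uniq.
by move=> [s t] [s' t'] _ _ /= [-> ->].
Qed.

(** By [chain_sum_cat] the chain sum of a flattened list is the convolution of those of its blocks,
    and each block is summed independently by [sum_comps]. *)
Lemma sum_refinements mu Q :
  \sum_(bl <- refinements mu) (\prod_(b <- bl) prefix_prod b)%:R^-1 *
     chain_sum [seq rooted_part r | r <- flatten bl] Q =
  chain_sum [seq natural_part m | m <- mu] Q.
Proof.
elim: mu Q => [|m mu IH] Q /=; first by rewrite big_seq1 big_nil invr1 mul1r.
rewrite big_allpairs_dep /=.
under [RHS]eq_bigr => D _ do rewrite -(sum_comps _ (leqnn m)) -IH big_distrlr /=.
rewrite [RHS]exchange_big; apply: eq_bigr => s _ /=.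
rewrite exchange_big; apply: eq_bigr => bl _ /=.
rewrite map_cat chain_sum_cat mulr_sumr; apply: eq_bigr => D _.
by rewrite big_cons natrM invfM mulrACA.
Qed.

End ChainSums.

(** * Monotone maps as chains of downsets *)

Section Coefficients.
Context {disp : Order.disp_t} {P : finPOrderType disp} {n : nat}.
Variable w : P -> 'I_n.
Hypothesis w_inj : injective w.
Variable d : P -> nat.
Hypothesis d_gt0 : forall a, (0 < d a)%N.
Implicit Types (Q R D : {set P}) (a b c x y z : P).

Definition monotone k (f : {ffun P -> 'I_k}) : bool :=
  [forall a, forall b, (a < b)%O ==> (f a <= f b)%N].

(** Maps defined on a subset of P are encoded as maps to ['I_k] with an added
    point [None], taken outside of the subset. *)
Definition monotone_on k Q (f : {ffun P -> option 'I_k}) : bool :=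
  [forall a, isSome (f a) == (a \in Q)] &&
  [forall a, forall b, (a < b)%O ==>
     if (f a, f b) is (Some i, Some j) then (i <= j)%N else true].

Lemma monotone_onP k Q (f : {ffun P -> option 'I_k}) :
  reflect ((forall a, isSome (f a) = (a \in Q)) /\
           forall a b i j, (a < b)%O -> f a = Some i -> f b = Some j -> (i <= j)%N)
          (monotone_on Q f).
Proof.
apply: (iffP andP) => -[s h]; split.
- by move=> a; apply/eqP; apply: (forallP s).
- by move=> a b i j ab fa fb; have /forallP/(_ b) := forallP h a; rewrite ab fa fb.
- by apply/forallP => a; apply/eqP.
- apply/forallP => a; apply/forallP => b; apply/implyP => ab.
  case fa: (f a) => [i|//]; case fb: (f b) => [j|//].
  exact: (h a b).
Qed.

Section ExtendMap.
Variables (k : nat) (D : {set P}).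

Definition extend_map (f : {ffun P -> option 'I_k}) : {ffun P -> option 'I_k.+1} :=
  [ffun a => if a \in D then Some ord0 else omap (lift ord0) (f a)].

Definition restrict_map (f : {ffun P -> option 'I_k.+1}) : {ffun P -> option 'I_k} :=
  [ffun a => obind (unlift ord0) (f a)].

(** A monotone map on [Q] amounts to its lowest fiber [D] and a monotone map on [Q :\: D]. The left
    side is shaped as the reindexing condition of [sum_monotone_on]. *)
Lemma extend_mapK Q f : downset Q D ->
  [&& monotone_on Q (extend_map f), [set a | extend_map f a == Some ord0]%SET == D
    & restrict_map (extend_map f) == f] =
  monotone_on (Q :\: D) f.
Proof.
move=> /downsetP[sDQ hD].
have fib0 : [set a | extend_map f a == Some ord0]%SET = D.
  apply/finset.setP => a; rewrite inE ffunE; case: ifP => // _.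
  by case: (f a) => //= i; apply/negbTE; apply/eqP => -[].
rewrite fib0 eqxx /=; apply/andP/monotone_onP => [[/monotone_onP[s h] /eqP e]|[s h]].
  have fD a : a \in D -> f a = None by move=> aD; rewrite -e !ffunE aD /= unlift_none.
  split=> [a|a b i j ab fa fb].
    rewrite inE; have [aD|aD] /= := boolP (a \in D); first by rewrite fD.
    by rewrite -s ffunE (negPf aD); case: (f a).
  have aD : a \notin D by apply/negP => /fD; rewrite fa.
  have bD : b \notin D by apply/negP => /fD; rewrite fb.
  have := h a b (lift ord0 i) (lift ord0 j) ab.
  by rewrite !ffunE (negPf aD) (negPf bD) fa fb => /(_ erefl erefl).
have fD a : a \in D -> f a = None.
  by move=> aD; have := s a; rewrite inE aD /=; case: (f a).
split.
  apply/monotone_onP; split=> [a|a b i j ab].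
    rewrite ffunE; have [aD|aD] := boolP (a \in D).
      by rewrite (fintype.subsetP sDQ).
    by have := s a; rewrite inE aD /= => <-; case: (f a).
  rewrite !ffunE; have [aD|aD] := boolP (a \in D); first by move=> [<-].
  case fa: (f a) => [i'|//] /= [<-].
  have aQ : a \in Q by have := s a; rewrite fa inE => /esym/andP[].
  case: ifP => [bD|_]; first by rewrite (hD a b) in aD.
  by case fb: (f b) => [j'|//] /= [<-]; rewrite !lift0; apply: (h a b).
apply/eqP/ffunP => a; rewrite !ffunE; case: ifP => [/fD->|_] /=.
  by rewrite unlift_none.
by case: (f a) => //= i; rewrite liftK.
Qed.

End ExtendMap.

(** The lowest fiber is a downset; splitting it off follows the recursion of [chain_sum]. *)
Lemma sum_monotone_on (T : Type) (x0 : T) (phi : T -> {set P} -> rat) s Q :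
  \sum_(f : {ffun P -> option 'I_(size s)} | monotone_on Q f)
    \prod_(i < size s) phi (nth x0 s i) [set a | f a == Some i]%SET =
  chain_sum [seq phi t | t <- s] Q.
Proof.
elim: s Q => [|t s IH] Q.
  rewrite [RHS]/=; under eq_bigr => f _ do rewrite big_ord0.
  have noneE (f : {ffun P -> option 'I_0}) a : f a = None by case: (f a) => // -[].
  case: (eqVneq Q finset.set0) => [->|Q0].
    rewrite (big_pred1 [ffun=> None]) // => f; apply/monotone_onP/eqP => [_|->].
      by apply/ffunP => a; rewrite noneE ffunE.
    by split=> [a|a b i j _]; rewrite ffunE ?inE.
  rewrite big_pred0 // => f; apply/negP => /monotone_onP[h _].
  by case/set0Pn: Q0 => a; rewrite -h noneE.
rewrite [size _]/= [chain_sum _ _]/=.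
pose fiber0 (f : {ffun P -> option 'I_(size s).+1}) := [set a | f a == Some ord0]%SET.
rewrite (partition_big fiber0 (downset Q)) /=; last first.
  move=> f /monotone_onP[s0 h]; apply/downsetP; split.
    by apply/fintype.subsetP => a; rewrite inE -s0 => /eqP->.
  move=> a b aQ; rewrite !inE => /eqP fb ab; move: (s0 a); rewrite aQ.
  case fa: (f a) => [i|//] _; have := h a b _ _ ab fa fb.
  by rewrite leqn0 => /eqP i0; apply/eqP; congr Some; apply: val_inj.
rewrite {}/fiber0; apply: eq_bigr => D dD; rewrite -IH mulr_sumr.
rewrite (reindex_onto (extend_map D) (@restrict_map _)) /=; last first.
  move=> f /andP[_ /eqP fD]; apply/ffunP => a; rewrite !ffunE -fD inE.
  case: eqP => [->//|]; case: (f a) => // i ni /=.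
  by case: unliftP => [j ->//|i0]; case: ni; rewrite i0.
apply: eq_big => [f|f fE]; first by rewrite -(extend_mapK f dD) andbA.
have : monotone_on (Q :\: D) f by rewrite -(extend_mapK f dD) andbA.
move: fE => /andP[/andP[_ /eqP fD] _] /monotone_onP[sf _].
rewrite big_ord_recl fD /=; congr (_ * _); apply: eq_bigr => i _; congr (phi _ _).
apply/finset.setP => a; rewrite !inE ffunE; case: ifP => [aD|_].
  by have := sf a; rewrite inE aD /=; case: (f a) => // _; apply/eqP => -[].
by case: (f a) => //= j; rewrite (inj_eq (@Some_inj _)) (inj_eq lift_inj).
Qed.

Lemma sum_monotone (T : Type) (x0 : T) (phi : T -> {set P} -> rat) s :
  \sum_(f : {ffun P -> 'I_(size s)} | monotone f)
    \prod_(i < size s) phi (nth x0 s i) (fiber f i) =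
  chain_sum [seq phi t | t <- s] [set: P]%SET.
Proof.
rewrite -(sum_monotone_on x0).
pose h (f : {ffun P -> 'I_(size s)}) := [ffun a => Some (f a)].
have h_inj : injective h.
  by move=> f g /ffunP e; apply/ffunP => a; have := e a; rewrite !ffunE => -[].
(* The [pick] is a partial inverse of the injection [h], defined on every map that is monotone on
   all of [P]. *)
rewrite [RHS](@reindex_omap _ _ _ _ _ h (fun g => [pick f | h f == g])) /=; last first.
  move=> g /monotone_onP[sg _]; case: pickP => [f /eqP<- //|].
  have gS a : {i | g a = Some i}.
    by have := sg a; rewrite inE; case: (g a) => // i _; exists i.
  move=> /(_ [ffun a => projT1 (gS a)])/eqP[].
  by apply/ffunP => a; rewrite !ffunE; case: (gS a) => i /= ->.
apply: eq_big => [f|f _].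
  have -> : [pick f0 | h f0 == h f] == Some f.
    by case: pickP => [f' /eqP/h_inj->|/(_ f)]; rewrite eqxx.
  rewrite andbT; apply/forallP/monotone_onP => [mf|[_ mf] a].
    split=> [a|a b i j ab]; first by rewrite ffunE inE.
    by rewrite !ffunE => -[<-] [<-]; have /forallP/(_ b) := mf a; rewrite ab.
  by apply/forallP => b; apply/implyP => ab; apply: (mf a b) => //; rewrite ffunE.
apply: eq_bigr => i _; congr (phi _ _); apply/finset.setP => a.
by rewrite !inE ffunE.
Qed.

(** Rootedness and weight are conditions on single fibers, so they turn into vanishing factors of
    the product. Surjectivity is automatic: a rooted fiber contains its root. *)
Lemma sum_rooted_surj (alpha : seq nat) :
  \sum_(f : {ffun P -> 'I_(size alpha)} | rooted_surj w f && (wt f d == alpha))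
     \prod_(i < size alpha)
        (lw_sgn w (fiber f i) * (weight_root w d (fiber f i))%:R) =
  chain_sum [seq rooted_part w d r | r <- alpha] [set: P]%SET.
Proof.
rewrite -(sum_monotone 0%N) big_mkcond [RHS]big_mkcond; apply: eq_bigr => f _.
have wtE : (wt f d == alpha) = [forall i, weight d (fiber f i) == nth 0%N alpha i].
  apply/eqP/forallP => [e i|h].
    rewrite -[in nth _ _]e (nth_map i) ?size_enum_ord //.
    by rewrite nth_ord_enum.
  apply: (@eq_from_nth _ 0%N); rewrite size_map size_enum_ord // => i lti.
  rewrite (nth_map (Ordinal lti)) ?size_enum_ord //.
  by rewrite (nth_ord_enum _ (Ordinal lti)); apply/eqP/h.
rewrite wtE /rooted_surj -/(monotone f).
case: (boolP (monotone f)) => mf; last by rewrite andbF.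
case: (boolP [forall i, is_rooted w (fiber f i)]) => rf; last first.
  rewrite !andbF; case/forallPn: rf => i /negPf ri.
  apply/esym/eqP/prodf_eq0; exists i => //.
  by rewrite /rooted_part /root_weight ri if_same.
case: (boolP [forall i, weight _ _ == _]) => wf; last first.
  rewrite andbF; case/forallPn: wf => i /negPf wi.
  by apply/esym/eqP/prodf_eq0; exists i; rewrite // /rooted_part wi.
rewrite !andbT; have -> : [forall i, exists a, f a == i].
  apply/forallP => i; have /lw_root_rooted[x _ fx] := forallP rf i.
  have : x \in Defs.tagged w (fiber f i) TagStar by rewrite fx finset.set11.
  by rewrite !inE => /andP[fxi _]; apply/existsP; exists x.
apply: eq_bigr => i _; rewrite /rooted_part (forallP wf i).
by rewrite /root_weight (forallP rf i).
Qed.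

Lemma sumn_wt k (f : {ffun P -> 'I_k}) : sumn (wt f d) = (\sum_a d a)%N.
Proof.
rewrite sumnE big_map big_enum /= (partition_big f xpredT) //=.
by apply: eq_bigr => i _; apply: eq_bigl => a; rewrite inE.
Qed.

(** * Coefficients of both sides at a fixed monomial [m] *)

Section Coefficient.
Variable m : {cmonom Defs.pnat}.

Definition supp : seq Defs.pnat :=
  sort (fun i j : Defs.pnat => (i <= j)%N) (finsupp (cmonom_val m)).

Definition exponents : seq nat := [seq m i | i <- supp].

Lemma mem_supp i : (i \in supp) = (m i != 0%N).
Proof. by rewrite mem_sort mem_finsupp. Qed.

Lemma supp_sorted : sorted (fun i j : Defs.pnat => (i < j)%N) supp.
Proof.
rewrite -(sorted_map (f := pnat_val) (e' := ltn)) ltn_sorted_uniq_leq.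
rewrite map_inj_uniq ?sort_uniq ?fset_uniq; last exact: val_inj.
by rewrite sorted_map; apply: sort_sorted => i j; apply: leq_total.
Qed.

Lemma ltp_trans : transitive (fun i j : Defs.pnat => (i < j)%N).
Proof. by move=> j i k; apply: ltn_trans. Qed.

Lemma ltp_irr : irreflexive (fun i j : Defs.pnat => (i < j)%N).
Proof. by move=> i; rewrite ltnn. Qed.

Lemma supp_uniq : uniq supp.
Proof. by rewrite sort_uniq fset_uniq. Qed.

Lemma exponents_composition : is_composition exponents.
Proof.
by rewrite /is_composition all_map; apply/allP => i /=; rewrite mem_supp lt0n.
Qed.

Variable p0 : Defs.pnat.

Lemma ltn_supp (i j : 'I_(size supp)) :
  (nth p0 supp i < nth p0 supp j)%N = (i < j)%N.
Proof.
have lt_homo := sorted_ltn_nth ltp_trans p0 supp_sorted.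
have [ij|ji|/val_inj->] := ltngtP i j; last by rewrite ltnn.
- by rewrite lt_homo ?inE.
- by apply/negbTE; rewrite -leqNgt ltnW // lt_homo ?inE.
Qed.

Lemma monomial_coefP (f : {ffun P -> Defs.pnat}) :
  reflect (forall v, (\sum_a (f a == v) * d a)%N = m v) (m == ppart_monom d f).
Proof.
by apply: (iffP (cmP _ _)) => h v; rewrite ?h /ppart_monom big_xpowE.
Qed.

(** Each [f] with monomial [m] takes its values in [supp], hence has this form for a unique [g]; the
    infinite sum thereby becomes finite. *)
Definition spread (g : {ffun P -> 'I_(size supp)}) : {ffun P -> Defs.pnat} :=
  [ffun a => nth p0 supp (g a)].

Lemma spread_inj : injective spread.
Proof.
move=> f g /ffunP e; apply/ffunP => a; have := e a; rewrite !ffunE => /eqP.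
by rewrite nth_uniq ?supp_uniq // => /eqP/val_inj.
Qed.

Definition natural_monotone (g : {ffun P -> 'I_(size supp)}) : bool :=
  monotone g &&
  [forall i, natural w (fiber g i) && (weight d (fiber g i) == m (nth p0 supp i))].

(** Strictness only adds something for pairs with equal values, that is inside one fiber, where it
    excludes every descent of labels. *)
Lemma spread_ppartition g : is_ppartition w (spread g) =
  monotone g && [forall i, natural w (fiber g i)].
Proof.
apply/forallP/andP => [h|[/forallP mg /forallP ng] a].
  split.
    apply/forallP => a; apply/forallP => b; apply/implyP => ab.
    have /forallP/(_ b) := h a; rewrite ab !ffunE /= => /andP[+ _].
    by rewrite leqNgt ltn_supp -leqNgt.
  apply/forallP => i; apply/naturalP => a b; rewrite !inE => /eqP ga /eqP gb ab.
  have /forallP/(_ b) := h a; rewrite ab !ffunE /= ga gb leqnn ltnn /= implybF -leqNgt.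
  rewrite leq_eqVlt => /orP[/eqP/val_inj/w_inj e|//].
  by rewrite e ltxx in ab.
apply/forallP => b; apply/implyP => ab; rewrite !ffunE leqNgt !ltn_supp -leqNgt.
have /forallP/(_ b) := mg a; rewrite ab /= => gab; rewrite gab /=.
apply/implyP => wba; rewrite ltn_neqAle gab andbT; apply/negP => /eqP/val_inj gE.
have /naturalP/(_ a b) := ng (g b); rewrite !inE gE eqxx => /(_ isT isT ab).
by rewrite ltnNge ltnW.
Qed.

Lemma spread_monom g : (m == ppart_monom d (spread g)) =
  [forall i, weight d (fiber g i) == m (nth p0 supp i)].
Proof.
have E (i : 'I_(size supp)) :
    (\sum_a (spread g a == nth p0 supp i) * d a)%N = weight d (fiber g i).
  rewrite /weight [RHS]big_mkcond; apply: eq_bigr => a _.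
  rewrite !ffunE inE nth_uniq ?supp_uniq // (inj_eq val_inj).
  by case: eqP; rewrite ?mul1n.
apply/monomial_coefP/forallP => [h i|h v]; first by rewrite -h E.
have [vs|vs] := boolP (v \in supp).
  move: (vs); rewrite -index_mem => lti.
  have := E (Ordinal lti); rewrite /= nth_index // => ->.
  by rewrite (eqP (h _)) nth_index.
move: (vs); rewrite mem_supp negbK => /eqP->; rewrite big1 // => a _.
case: eqP => [e|]; last by rewrite mul0n.
by rewrite -e ffunE mem_nth in vs.
Qed.

Lemma natural_monotoneE g : natural_monotone g =
  is_ppartition w (spread g) && (m == ppart_monom d (spread g)).
Proof.
rewrite spread_ppartition spread_monom -andbA; congr (_ && _).
apply/forallP/andP => [h|[/forallP ng /forallP wg] i]; last by rewrite ng wg.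
by split; apply/forallP => i; have /andP[] := h i.
Qed.

Lemma Kgen_coef : Kgen w d m =
  chain_sum [seq natural_part w d r | r <- exponents] [set: P]%SET.
Proof.
rewrite -map_comp -(sum_monotone p0 (fun v => natural_part w d (m v))).
transitivity (\sum_(g | natural_monotone g) (1 : rat)); last first.
  rewrite big_mkcond [RHS]big_mkcond; apply: eq_bigr => g _.
  rewrite /natural_monotone; case: (monotone g) => //=.
  case: forallP => [h|/forallP/forallPn[i /negPf ni]].
    by rewrite big1 // => i _; rewrite /natural_part h.
  by apply/esym/eqP/prodf_eq0; exists i; rewrite // /natural_part ni.
rewrite /Kgen /fps_sum /fps_monom.
rewrite (fsbigE [seq spread g | g <- enum natural_monotone]) /=.
- rewrite big_map big_enum_cond /=; apply: eq_big => g.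
    apply/andP/idP => [[]//|gn]; split=> //; apply/mem_set => /=.
    by move: gn; rewrite natural_monotoneE => /andP[].
  by case/andP; rewrite [_ \in _]natural_monotoneE => /andP[_ ->].
- by rewrite map_inj_uniq ?enum_uniq //; apply: spread_inj.
- move=> f /= /mapP[g]; rewrite mem_enum [_ \in _]natural_monotoneE.
  by move=> /andP[? _] ->.
(* A partition contributing to [m] is the [spread] of its positions in [supp], so it is on the
   list. *)
- move=> f pf nf; case: eqP => // mf; case/negP: nf.
  have fs a : (index (f a) supp < size supp)%N.
    by rewrite index_mem mem_sort mf; apply: (@big_xpow_supp _ f d a).
  have ef : f = spread [ffun a => Ordinal (fs a)].
    by apply/ffunP => a; rewrite !ffunE /= nth_index // -index_mem.
  rewrite ef map_f // mem_enum [_ \in _]natural_monotoneE -ef pf.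
  by rewrite -mf eqxx.
Qed.

(** An increasing tuple giving [m] must be the sorted support, and its exponents are then read off
    from [m]. *)
Lemma Mqsym_coef beta : is_composition beta ->
  Mqsym beta m = (beta == exponents)%:R.
Proof.
move=> /(all_nthP 0%N) b_gt0.
have key (i : (size beta).-tuple Defs.pnat) :
    sorted (fun j k : Defs.pnat => (j < k)%N) i -> m = Mqsym_monom i ->
    val i = supp /\ beta = exponents.
  move=> si em.
  have mE v : m v = (\sum_(j < size beta) (tnth i j == v) * nth 0 beta j)%N.
    by rewrite em /Mqsym_monom big_xpowE.
  have ui : uniq i by apply: sorted_uniq si; [exact: ltp_trans|exact: ltp_irr].
  have mi (j : 'I_(size beta)) : m (tnth i j) = nth 0%N beta j.
    rewrite mE (bigD1 j) //= eqxx mul1n big1 ?addn0 // => k kj.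
    by rewrite !(tnth_nth p0) nth_uniq ?size_tuple // (inj_eq val_inj) (negPf kj).
  have ei : val i = supp.
    apply: (irr_sorted_eq ltp_trans ltp_irr si supp_sorted) => v.
    rewrite mem_supp; apply/idP/idP => [/tnthP[j ->]|].
      by rewrite mi -lt0n; apply: b_gt0.
    apply: contraNT => vi; rewrite mE big1 // => j _; case: eqP => [e|//].
    by rewrite -e mem_tnth in vi.
  split=> //; rewrite /exponents -ei; apply: (@eq_from_nth _ 0%N).
    by rewrite size_map size_tuple.
  move=> j ltj; rewrite (nth_map p0) ?size_tuple //.
  by rewrite -(mi (Ordinal ltj)) (tnth_nth p0).
rewrite /Mqsym /fps_sum /fps_monom.
case: eqP => [e|ne]; last first.
  by apply: fsbig1 => i /= si; case: eqP => // /(key i si)[].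
subst beta; have sz : size supp == size exponents by rewrite size_map.
pose t := Tuple sz.
have mt : m = Mqsym_monom t.
  apply/eqP/cmP => v; rewrite /Mqsym_monom big_xpowE.
  have [vs|vs] := boolP (v \in supp).
    move: (vs); rewrite -index_mem (eqP sz) => lti.
    rewrite (bigD1 (Ordinal lti)) //= (tnth_nth p0) /= nth_index // eqxx mul1n.
    rewrite (nth_map p0) ?(eqP sz) // nth_index // big1 ?addn0 // => j jv.
    case: eqP => // e; case/eqP: jv; apply: val_inj => /=.
    by rewrite -e (tnth_nth p0) index_uniq ?supp_uniq // (eqP sz).
  move: (vs); rewrite mem_supp negbK => /eqP->; rewrite big1 // => j _.
  by case: eqP => // e; have := mem_tnth j t; rewrite e (negPf vs).
rewrite (fsbigE [:: t]) //.
- rewrite big_cons big_nil ifT; first by rewrite -mt eqxx /= addr0.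
  by apply/mem_set; apply: supp_sorted.
- by move=> i /=; rewrite inE => /eqP->; apply: supp_sorted.
- move=> i /= si; rewrite inE => ni; case: eqP => // /(key i si)[ei _].
  by case/eqP: ni; apply: val_inj.
Qed.

Lemma psihat_coef alpha : is_composition alpha -> psihat alpha m =
  if `[< refines alpha exponents >] then (pi_refine alpha exponents)%:R^-1 else 0.
Proof.
move=> ca; have fin := finite_refines ca.
transitivity (\sum_(beta \in [set beta | refines alpha beta]%classic)
    ((pi_refine alpha beta)%:R^-1 : rat) * (beta == exponents)%:R).
  rewrite /psihat !fsbig_finite //= fct_sumE; apply: eq_big_seq => beta.
  rewrite in_fset_set // => /set_mem /(refines_composition ca)[cb _].
  by rewrite -Mqsym_coef.
case: asboolP => ref; last first.
  apply: fsbig1 => beta /= rb; case: eqP => [e|_]; last by rewrite mulr0.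
  by rewrite e in rb.
rewrite (fsbigE [:: exponents]) //.
- by rewrite big_cons big_nil ifT; [rewrite eqxx /= addr0 mulr1|apply/mem_set].
- by move=> beta /=; rewrite inE => /eqP->.
- by move=> beta _ /=; rewrite inE => /negPf->; rewrite mulr0.
Qed.

Lemma refinements_blocks bl : bl \in refinements exponents ->
  is_composition (flatten bl) /\ is_blocks (flatten bl) exponents bl.
Proof.
rewrite mem_refinements => /andP[cbl /eqP sbl]; split.
  elim: bl cbl {sbl} => //= b bl IH /andP[cb /IH cbl].
  by rewrite /is_composition all_cat; apply/andP.
rewrite /is_blocks eqxx sbl eqxx !andbT; apply/negP => /(map_f sumn).
by rewrite sbl => /(allP exponents_composition).
Qed.

(** Only refinements of [exponents] contribute, and [flatten] is a bijection from block
    decompositions to them because decompositions of compositions are unique. *)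
Lemma sum_psihat_coef (c : seq nat -> rat) :
  \sum_(alpha \in [set alpha | is_composition alpha]%classic) c alpha * psihat alpha m =
  \sum_(bl <- refinements exponents)
     (\prod_(b <- bl) prefix_prod b)%:R^-1 * c (flatten bl).
Proof.
rewrite (fsbigE [seq flatten bl | bl <- refinements exponents]).
- rewrite big_map big_seq_cond [RHS]big_seq; apply: eq_big => bl.
    apply/andP/idP => [[]//|Bbl]; split=> //; apply/mem_set => /=.
    by case: (refinements_blocks Bbl).
  move=> /andP[/refinements_blocks[cb bb] _]; rewrite psihat_coef // asboolT;
    last by exists bl.
  rewrite mulrC; congr (_%:R^-1 * _); rewrite /pi_refine.
  (* [blocks] is an arbitrary choice, identified with [bl] by uniqueness. *)
  suff -> : blocks (flatten bl) exponents = bl by [].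
  rewrite /blocks; case: xgetP => [bl' _ /= bb'|/(_ bl)//].
  exact: is_blocks_inj cb bb' bb.
- rewrite map_inj_in_uniq ?refinements_uniq // => bl bl'.
  move=> /refinements_blocks[cb bb] /refinements_blocks[cb' bb'] e.
  by apply: is_blocks_inj cb bb _; rewrite e.
- by move=> alpha /= /mapP[bl /refinements_blocks[cb _] ->].
- move=> alpha /= ca na; rewrite psihat_coef //.
  case: asboolP => [[bl bb]|_]; last by rewrite mulr0.
  case/mapP: na; exists bl; have /and3P[_ /eqP fa sa] := bb; last by rewrite fa.
  rewrite mem_refinements sa andbT; move: ca; rewrite -fa.
  rewrite /is_composition; elim: (bl) => //= b bl' IH; rewrite all_cat.
  by case/andP=> cb /IH cbl; apply/andP.
Qed.

End Coefficient.

End Coefficients.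

(** * Comparison of the coefficients *)

Theorem theorem20 (disp : Order.disp_t) (P : finPOrderType disp) (n : nat)
    (w : P -> 'I_n) (d : P -> nat)
    (w_bij : bijective w) (d_gt0 : forall a : P, (0 < d a)%N) :
  Kgen w d =
  \sum_(alpha \in compositions (\sum_(a : P) d a)%N)
     (\sum_(f : {ffun P -> 'I_(size alpha)} | rooted_surj w f && (wt f d == alpha))
        \prod_(i < size alpha)
           (lw_sgn w (fiber f i) * (weight_root w d (fiber f i))%:R))
     *: psihat alpha.
Proof.
have w_inj := bij_inj w_bij; apply/funext => m.
pose p0 : Defs.pnat := @PNat 1 isT; pose N := (\sum_(a : P) d a)%N.
pose c alpha := chain_sum [seq rooted_part w d r | r <- alpha] [set: P]%SET.
rewrite (Kgen_coef w_inj d_gt0 m p0) -(sum_refinements w_inj d_gt0).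
rewrite -(sum_psihat_coef m p0 c).
have fin := finite_compositions N.
transitivity (\sum_(alpha \in compositions N) c alpha * psihat alpha m); last first.
  rewrite !fsbig_finite // fct_sumE; apply: eq_bigr => alpha _.
  by rewrite sum_rooted_surj.
(* The sum extends from compositions of [N] to all compositions: every [wt f d] has sum [N], so for
   other [alpha] the sum defining [c alpha] is empty. *)
apply/esym/fsbig_widen => [alpha []//|alpha [/= ca nN]].
rewrite /c -sum_rooted_surj big_pred0 ?mul0r // => f.
by apply/negP => /andP[_ /eqP e]; apply: nN; split=> //; rewrite -e sumn_wt.
Qed.
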